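(* Let $\mathcal{F}$ be a finite family of count-based learning rules, each with memory length $m\ge 1$, let the opponent use an unknown rule $f^*\in\mathcal{F}$, suppose all payoffs of player $A$ lie in $[0,1]$ and suppose a blank action exists. Then the unknown-opponent algorithm (described in the context, with the MOSS bandit algorithm) gives a $1/2$-approximation up to $O(\sqrt{|\mathcal{F}|mT}+m)$ regret to the optimal expected payoff against the actual opponent: there is an absolute constant $C$ such that its expected cumulative payoff over $T$ rounds is at least $$\tfrac12\mathrm{OPT}-C\big(\sqrt{|\mathcal{F}|\,m\,T}+m\big),$$ where $\mathrm{OPT}$ is the maximum expected cumulative payoff over $T$ rounds of an action sequence of player $A$ against $f^*$.
   Context: Setting. A two-player normal-form game is repeated for $T$ rounds. Player $A$ has actions $\mathcal{A}=\{a_1,\dots,a_{k_A}\}$, player $B$ has actions $\mathcal{B}=\{b_1,\dots,b_{k_B}\}$, with utilities $u^A,u^B:\mathcal{A}\times\mathcal{B}\to\mathbb{R}$. For $\beta\in\Delta(\mathcal{B})$, $\bar u^A(a,\beta)=\sum_j\beta(b_j)u^A(a,b_j)$. A count-based learning rule $f$ with memory $m$ maps count vectors in $\mathbb{N}^{k_A}$ with sum at most $m$ to $\Delta(\mathcal{B})$: in round $t$, player $B$ draws its action (with fresh independent randomness) from $f$ applied to the counts of $A$'s actions in the last $\min(m,t-1)$ rounds. For a sequence of at most $m$ actions, $f([x_1,\dots,x_j])$ denotes $f$ applied to its counts. The expected cumulative payoff of $x_1,\dots,x_T$ against $f$ is $\sum_{t=1}^T\bar u^A(x_t,f([x_{\max(1,t-m)},\dots,x_{t-1}]))$.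 Blank action: an action $a_\varnothing\in\mathcal{A}$ with $u^A(a_\varnothing,b)=u^B(a_\varnothing,b)=0$ for all $b\in\mathcal{B}$ such that playing it $m$ times restores the opponent's behaviour to what it would be at the beginning of the game; i.e., for every $f\in\mathcal{F}$, every $0\le j\le m$ and all $x_1,\dots,x_j\in\mathcal{A}$, $f$ gives the same output on the history consisting of $m-j$ blank actions followed by $x_1,\dots,x_j$ as on the history $x_1,\dots,x_j$. MOSS on $K$ arms with horizon $N$ and rewards in $[0,1]$: pull each arm once, then in each round pull an arm $i$ maximizing $\hat\mu_{i}+\sqrt{\max(\ln(N/(Ks_i)),0)/s_i}$, where $s_i$ is the number of past pulls of arm $i$ and $\hat\mu_i$ its average observed reward. Its expected regret, compared with always pulling the arm of highest mean, is known to be $O(\sqrt{KN})$ for i.i.d. rewards in $[0,1]$ per arm. Unknown-opponent algorithm. Input: $\mathcal{F}$, $m$, $T$ and the game (not $f^*$). For each $f\in\mathcal{F}$ compute $S_f\in\mathcal{A}^{2m}$, a sequence of length $2m$ maximizing $A$'s expected payoff in its last $m$ time steps if the opponent uses $f$. Let $T'=\lfloor T/(2m)\rfloor$. Run MOSS over $T'$ bandit rounds with $|\mathcal{F}|$ arms: pulling the arm of $f$ means playing the $2m$ actions of $S_f$, and its reward is the realized payoff over the last $m$ of these steps (divided by $m$ to lie in $[0,1]$). Then play arbitrary actions in the remaining $T-2mT'$ rounds. *)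

(* Defs.v *)
From HB Require Import structures.
From mathcomp Require Import all_boot all_order all_algebra.
From mathcomp Require Import reals exp.

Set Implicit Arguments.
Unset Strict Implicit.
Unset Printing Implicit Defensive.

Import Order.TTheory GRing.Theory Num.Theory.
Local Open Scope ring_scope.

Definition is_dist (R : realType) (B : finType) (p : B -> R) : Prop :=
  (forall b, 0 <= p b) /\ \sum_b p b = 1.

(* [mean_payoff u a beta] is u-bar(a, beta). *)
Definition mean_payoff (R : realType) (A B : finType) (u : A -> B -> R)
    (a : A) (beta : B -> R) : R :=
  \sum_b beta b * u a b.

Definition counts (A : finType) (s : seq A) : {ffun A -> nat} :=
  [ffun a => count_mem a s].

Definition recent (X : Type) (m : nat) (s : seq X) : seq X :=
  drop (size s - m) s.

(* A rule is a total function on count vectors, but only its values on vectors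
   of sum at most m are constrained, and only those are ever used. *)
Definition is_rule (R : realType) (A B : finType) (m : nat)
    (f : {ffun A -> nat} -> B -> R) : Prop :=
  forall c : {ffun A -> nat}, (\sum_a c a <= m)%N -> is_dist (f c).

Definition is_blank (R : realType) (A B I : finType) (uA uB : A -> B -> R)
    (m : nat) (F : I -> {ffun A -> nat} -> B -> R) (blank : A) : Prop :=
  (forall b, uA blank b = 0 /\ uB blank b = 0) /\
  forall (i : I) (s : seq A), (size s <= m)%N ->
    F i (counts (nseq (m - size s) blank ++ s)) =1 F i (counts s).

(* Rounds are numbered from 0: in round t the past actions are [take t x]. *)
Definition round_payoff (R : realType) (A B : finType) (u : A -> B -> R)
    (m : nat) (f : {ffun A -> nat} -> B -> R) (n : nat) (x : n.-tuple A)
    (t : 'I_n) : R :=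
  mean_payoff u (tnth x t) (f (counts (recent m (take t x)))).

Definition seq_payoff (R : realType) (A B : finType) (u : A -> B -> R)
    (m : nat) (f : {ffun A -> nat} -> B -> R) (n : nat) (x : n.-tuple A) : R :=
  \sum_(t < n) round_payoff u m f x t.

(* The default value 0 of the iterated maximum is harmless for u >= 0 (and
   A nonempty): all the payoffs are then nonnegative. *)
Definition opt (R : realType) (A B : finType) (u : A -> B -> R)
    (m : nat) (f : {ffun A -> nat} -> B -> R) (T : nat) : R :=
  \big[Num.max/0]_(x : T.-tuple A) seq_payoff u m f x.

Definition last_m_payoff (R : realType) (A B : finType) (u : A -> B -> R)
    (m : nat) (f : {ffun A -> nat} -> B -> R) (x : (2 * m).-tuple A) : R :=
  \sum_(t < 2 * m | (m <= t)%N) round_payoff u m f x t.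

Definition is_best_block (R : realType) (A B : finType) (u : A -> B -> R)
    (m : nat) (f : {ffun A -> nat} -> B -> R) (S : (2 * m).-tuple A) : Prop :=
  forall x : (2 * m).-tuple A, last_m_payoff u f x <= last_m_payoff u f S.

(* An adaptive strategy of player A maps the full history of play (pairs of
   actions of A and B, oldest first) to A's next action. *)
Definition play (A B : Type) (sigma : seq (A * B) -> A) (bs : seq B) :
    seq (A * B) :=
  foldl (fun h b => rcons h (sigma h, b)) [::] bs.

(* Probability that B's actions over T rounds are bs when A follows sigma:
   given the past, B's action is drawn from f at the current counts of A. *)
Definition play_prob (R : realType) (A B : finType) (m : nat)
    (f : {ffun A -> nat} -> B -> R) (sigma : seq (A * B) -> A) (T : nat)
    (bs : T.-tuple B) : R :=
  \prod_(t < T)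
    f (counts (recent m [seq p.1 | p <- take t (play sigma bs)])) (tnth bs t).

Definition strategy_payoff (R : realType) (A B : finType) (u : A -> B -> R)
    (m : nat) (f : {ffun A -> nat} -> B -> R) (sigma : seq (A * B) -> A)
    (T : nat) : R :=
  \sum_(bs : T.-tuple B)
    play_prob m f sigma bs * \sum_(p <- play sigma bs) u p.1 p.2.

(* Bandit histories are sequences of (arm, observed reward), oldest first. *)
Definition pulls (R : realType) (I : finType) (h : seq (I * R)) (i : I) : nat :=
  count (fun p => p.1 == i) h.

Definition moss_index (R : realType) (I : finType) (N : nat)
    (h : seq (I * R)) (i : I) : R :=
  let s := pulls h i in
  (\sum_(p <- h | p.1 == i) p.2) / s%:R +
  Num.sqrt (Num.max (ln (N%:R / (#|I| * s)%N%:R)) 0 / s%:R).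

(* The order of the initial pulls and the tie-breaking are left arbitrary. *)
Definition is_moss (R : realType) (I : finType) (N : nat)
    (pi : seq (I * R) -> I) : Prop :=
  forall h : seq (I * R), (size h < N)%N ->
    ((exists i, pulls h i = 0%N) -> pulls h (pi h) = 0%N) /\
    ((forall i, (0 < pulls h i)%N) ->
       forall j, moss_index N h j <= moss_index N h (pi h)).

(* Normalized realized payoff of A over the last m steps of the k-th block of
   2m rounds of the history h. *)
Definition block_reward (R : realType) (A B : finType) (u : A -> B -> R)
    (m : nat) (h : seq (A * B)) (k : nat) : R :=
  (\sum_(p <- take m (drop (k * (2 * m) + m) h)) u p.1 p.2) / m%:R.

(* Bandit history formed by the first k blocks of h, when the arm of each
   block is chosen by pi. *)
Fixpoint bandit_history (R : realType) (A B I : finType) (u : A -> B -> R)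
    (m : nat) (pi : seq (I * R) -> I) (h : seq (A * B)) (k : nat) :
    seq (I * R) :=
  if k is k'.+1 then
    let g := bandit_history u m pi h k' in rcons g (pi g, block_reward u m h k')
  else [::].

(* S gives the block played for each arm, rest the arbitrary actions of the
   last T - 2mT' rounds. The default value of nth is never used, since
   S has size 2m > size h %% (2m). *)
Definition unknown_opponent_alg (R : realType) (A B I : finType)
    (u : A -> B -> R) (m T : nat) (S : I -> (2 * m).-tuple A)
    (pi : seq (I * R) -> I) (rest : seq (A * B) -> A) (h : seq (A * B)) : A :=
  let k := (size h %/ (2 * m))%N in
  if (k < T %/ (2 * m))%N then
    nth (rest h) (S (pi (bandit_history u m pi h k))) (size h %% (2 * m))%N
  else rest h.

(* Main.v *)
(** The proof of the MOSS bound avoids maximal inequalities. For an arm [i] let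
    [G] be the sum of the observed rewards minus its mean. By Hoeffding's lemma
    [exp (l * G - l^2/8 * pulls)] is a nonnegative supermartingale under any
    adaptive policy. The shortfall of the index of the best arm is at most a
    weighted sum of these exponentials over a dyadic family of rates [l] (one for
    each range [2^j <= pulls < 2^(j+1)]), and the pulls of a suboptimal arm that
    are due to an overestimated index are paid for by the decrease of
    [exp (gap * G - gap^2/4 * pulls)]. All this fits in one potential function
    that bounds the regret by backward induction on the number of rounds left.

    For the game, the payoffs in the second half of a block depend only on the
    actions of that block, so the blocks form a bandit in which the arm of the
    true rule is the best one; by the blank action, any [m] consecutive rounds of
    any action sequence yield at most the value of that arm, while the algorithm
    collects this value once every [2m] rounds. *)
Require Import Defs.
From HB Require Import structures.
From mathcomp Require Import all_boot all_order all_algebra.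
From mathcomp Require Import reals normedtype sequences derive exp.
From mathcomp Require Import ring lra zify.

Set Implicit Arguments.
Unset Strict Implicit.
Unset Printing Implicit Defensive.

Import Order.TTheory GRing.Theory Num.Theory.
Import numFieldNormedType.Exports.
Local Open Scope ring_scope.

(** * Hoeffding's lemma *)

Lemma le_of_deriv_ge0 (R : realType) (f df : R -> R) :
  (forall x : R, is_derive x 1 f (df x)) -> (forall x, 0 <= x -> 0 <= df x) ->
  forall x, 0 <= x -> f 0 <= f x.
Proof.
move=> fdf df0 x x0.
have [y /andP[y0 _]] : exists2 y, 0 <= y <= x & f x - f 0 = df y * (x - 0).
  have [|y yI fE] := MVT_segment x0 (fun z _ => fdf z).
    by apply: derivable_within_continuous => z _; exact: ex_derive.
  by exists y => //; move: yI; rewrite in_itv.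
by move=> fE; rewrite -subr_ge0 fE subr0 mulr_ge0 // df0.
Qed.

(** This is [tanh (x / 2) <= x / 2] without denominators; the derivative of the difference is
    nonnegative because [1 - t <= expR (- t)]. *)
Lemma half_tanh_le (R : realType) (x : R) : 0 <= x ->
  2 * (expR x - 1) <= x * (expR x + 1).
Proof.
move=> x0; rewrite -subr_ge0.
pose f (t : R) : R := t * (expR t + 1) - 2 * (expR t - 1).
pose df (t : R) : R := t * expR t - expR t + 1.
have -> : 0 = f 0 by rewrite /f expR0; ring.
apply: (@le_of_deriv_ge0 _ f df) x0 => t.
  apply: is_derive_eq; rewrite /df /GRing.scale /=; ring.
move=> t0; rewrite /df.
have := expR_ge1Dx (- t); have := expR_gt0 t.
have : expR t * expR (- t) = 1 by rewrite expRxMexpNx_1.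
nra.
Qed.

(** The quotient of the two sides is 1 at [l = 0] and does not increase. This amounts to [p * expR t
    <= (p + t / 4) * (1 - p + p * expR t)]: the mean of the exponentially tilted law exceeds [p] by
    at most [t / 4]. *)
Lemma hoeffding_bernoulli_ge0 (R : realType) (p l : R) : 0 <= p <= 1 -> 0 <= l ->
  (1 - p) + p * expR l <= expR (p * l + l ^+ 2 / 8).
Proof.
move=> /andP[p0 p1] l0.
pose f (t : R) : R := - ((1 - p + p * expR t) * expR (- (p * t + t * t / 8))).
pose df (t : R) : R := ((p + t / 4) * (1 - p + p * expR t) - p * expR t)
                        * expR (- (p * t + t * t / 8)).
have le0 : f 0 <= f l.
  apply: (@le_of_deriv_ge0 _ f df) l0 => t.
    apply: is_derive_eq; rewrite /df /GRing.scale /=; lra.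
  move=> t0; rewrite /df mulr_ge0 ?expR_ge0 //.
  have := @half_tanh_le R (t / 2) ltac:(lra).
  have -> : expR t = expR (t / 2) ^+ 2 by rewrite -expRM_natl; congr expR; field.
  have : 1 <= expR (t / 2) by have := expR_ge1Dx (t / 2); lra.
  set e := expR _ => e1 tanh.
  (* The square equals [1 - p + p * e ^+ 2 - p * (1 - p) * (e + 1) ^+ 2]; what then remains is
     [tanh (t / 4) <= t / 4]. *)
  have H : 0 <= ((1 - p) - p * e) ^+ 2 by exact: sqr_ge0.
  suff : p * (1 - p) * (e ^+ 2 - 1) <= t / 4 * (1 - p + p * e ^+ 2) by nra.
  have : p * (1 - p) * (e + 1) ^+ 2 * (e - 1) <= (1 - p + p * e ^+ 2) * (e - 1) by nra.
  have : 0 <= 1 - p + p * e ^+ 2 by nra.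
  have ep : 0 < e + 1 by lra.
  move=> q0 h2; rewrite -(ler_pM2r ep); nra.
move: le0; rewrite /f lerN2 expRN ler_pdivrMr ?expR_gt0 // expr2 => /le_trans; apply.
by rewrite !(mul0r, mulr0, addr0, oppr0, expR0, mulr1) subrK mul1r.
Qed.

(** For [l < 0], exchanging the outcomes 0 and 1 turns [(p, l)] into [(1 - p, - l)] and multiplies
    the left side by [expR (- l)]. *)
Lemma hoeffding_bernoulli (R : realType) (p l : R) : 0 <= p <= 1 ->
  (1 - p) + p * expR l <= expR (p * l + l ^+ 2 / 8).
Proof.
move=> p01; case: (leP 0 l) => [l0|l0]; first exact: hoeffding_bernoulli_ge0.
have := @hoeffding_bernoulli_ge0 R (1 - p) (- l) ltac:(lra) ltac:(lra).
move=> H; rewrite -(ler_pM2r (expR_gt0 (- l))) mulrDl -mulrA expRxMexpNx_1.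
rewrite -expRD; apply: le_trans (le_trans H _); first lra.
rewrite ler_expR; lra.
Qed.

(** The chord of the exponential reduces an arbitrary law on [0, 1] to the Bernoulli law of the same
    mean. *)
Lemma hoeffding_lemma (R : realType) (O : finType) (p r : O -> R) (l mu : R) :
  is_dist p -> (forall o, 0 <= r o <= 1) -> \sum_o p o * r o = mu ->
  \sum_o p o * expR (l * (r o - mu)) <= expR (l ^+ 2 / 8).
Proof.
move=> [p0 p1] r01 rmu.
have mu01 : 0 <= mu <= 1.
  rewrite -rmu sumr_ge0 /= => [|o _]; last by have := p0 o; have := r01 o; nra.
  rewrite -p1 ler_sum // => o _; have := p0 o; have := r01 o; nra.
(* convexity of exp: the chord on [0, 1] *)
have chord t : 0 <= t <= 1 -> expR (l * t) <= (1 - t) + t * expR l.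
  move=> t01.
  (* Tangent bounds at [l * t] for the ends 0 and [l], divided by [expR (l * t)]; averaging them
     with weights [1 - t] and [t] gives the chord bound. *)
  have h0 := expR_ge1Dx (- (l * t)); have h1 := expR_ge1Dx (l - l * t).
  have e0 := expR_gt0 (l * t).
  have E0 : expR (l * t) * expR (- (l * t)) = 1 by rewrite expRxMexpNx_1.
  have E1 : expR (l * t) * expR (l - l * t) = expR l.
    by rewrite -expRD; congr expR; ring.
  have : 1 <= (1 - t) * expR (- (l * t)) + t * expR (l - l * t) by nra.
  rewrite -E1 -(ler_pM2l e0) mulr1 mulrDr !(mulrCA (expR (l * t))) E0 mulr1.
  by apply: le_trans.
have -> : \sum_o p o * expR (l * (r o - mu)) =
          expR (- (l * mu)) * \sum_o p o * expR (l * r o).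
  rewrite mulr_sumr; apply: eq_bigr => o _.
  by rewrite mulrBr expRD; ring.
have : \sum_o p o * expR (l * r o) <= (1 - mu) + mu * expR l.
  have -> : (1 - mu) + mu * expR l = \sum_o p o * ((1 - r o) + r o * expR l).
    under eq_bigr => o _ do rewrite mulrDr mulrBr mulr1 mulrA.
    by rewrite big_split sumrB /= -mulr_suml rmu p1.
  by apply: ler_sum => o _; rewrite ler_wpM2l ?chord.
move=> H; apply: le_trans (ler_wpM2l (expR_ge0 _) H) _.
apply: le_trans (ler_wpM2l (expR_ge0 _) (@hoeffding_bernoulli R mu l mu01)) _.
by rewrite -expRD ler_expR; lra.
Qed.

(** * Regret of MOSS *)

(* Makes [dyadic_sum] telescope: [w] is the square root of [a * 2 ^ j], which is
   multiplied by [t = sqrt 2] from one range to the next. *)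
Lemma dyadic_step (R : realType) (t w : R) : 0 <= t -> t ^+ 2 = 2 -> 0 < w ->
  Num.min 1 (w ^+ 2) / w <= 13 * (t * w / (1 + t * w) - w / (1 + w)).
Proof.
move=> t0 t2 w0.
have t14 : 7 / 5 <= t by nra.
have t15 : t <= 3 / 2 by nra.
have tw : 0 < 1 + t * w by nra.
have w1 : 0 < 1 + w by lra.
have -> : t * w / (1 + t * w) - w / (1 + w) = (t - 1) * w / ((1 + t * w) * (1 + w)).
  by field; rewrite !gt_eqF.
rewrite mulrA ler_pdivrMr // mulrAC ler_pdivlMr ?mulr_gt0 //.
(* In both cases [(1 + t * w) * (1 + w)] is at most 5 times the larger of 1 and [w ^+ 2], while
   [13 * (t - 1) >= 13 * (2 / 5) > 5]; hence the constant 13. *)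
case: (leP 1 w) => w1'.
  have -> : Num.min 1 (w ^+ 2) = 1 by apply: min_idPl; nra.
  have : (1 + t * w) * (1 + w) <= (5 / 2 * w) * (2 * w) by apply: ler_pM; nra.
  nra.
have -> : Num.min 1 (w ^+ 2) = w ^+ 2 by apply: min_idPr; nra.
have : (1 + t * w) * (1 + w) <= (5 / 2) * 2 by apply: ler_pM; nra.
nra.
Qed.

(** The terms grow geometrically while [a * 2 ^+ j <= 1] and decay geometrically afterwards, with a
    peak of order [Num.sqrt a]. Telescoping [g], whose values lie in [0, 1], avoids splitting the
    sum at the peak. *)
Lemma dyadic_sum (R : realType) (a : R) (n : nat) : 0 < a ->
  \sum_(j < n) Num.min 1 (a * 2 ^+ j) / Num.sqrt (2 ^+ j) <= 13 * Num.sqrt a.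
Proof.
move=> a0.
pose w (j : nat) : R := Num.sqrt (a * 2 ^+ j).
pose g (j : nat) : R := w j / (1 + w j).
have aj0 j : 0 <= a * 2 ^+ j by rewrite ltW // mulr_gt0 ?exprn_gt0.
have w0 j : 0 < w j by rewrite sqrtr_gt0 mulr_gt0 ?exprn_gt0.
have wS j : w j.+1 = Num.sqrt 2 * w j.
  by rewrite /w exprS mulrCA sqrtrM.
rewrite -(big_mkord xpredT (fun j => Num.min 1 (a * 2 ^+ j) / Num.sqrt (2 ^+ j))).
apply: (@le_trans _ _ (\sum_(0 <= j < n) 13 * Num.sqrt a * (g j.+1 - g j))).
  apply: ler_sum => j _.
  have := @dyadic_step R (Num.sqrt 2) (w j) (sqrtr_ge0 _) _ (w0 j).
  rewrite sqr_sqrtr // => /(_ erefl).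
  rewrite -wS -/(g j) -/(g j.+1) {1}/w sqr_sqrtr; last exact: aj0.
  move=> H; rewrite mulrAC [X in _ <= X]mulrC.
  have sa : 0 < Num.sqrt a by rewrite sqrtr_gt0.
  have -> : Num.min 1 (a * 2 ^+ j) / Num.sqrt (2 ^+ j) =
            Num.sqrt a * (Num.min 1 (a * 2 ^+ j) / w j).
    by rewrite /w (sqrtrM _ (ltW a0)); field; rewrite !gt_eqF ?sqrtr_gt0 ?exprn_gt0.
  by rewrite ler_pM2l.
rewrite -mulr_sumr telescope_sumr // ler_piMr ?mulr_ge0 ?sqrtr_ge0 //.
have g01 j : 0 <= g j <= 1.
  have := w0 j => wj; rewrite /g divr_ge0 ?ler_pdivrMr /=; lra.
by have := g01 n; have := g01 0%N; lra.
Qed.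

(* [x] is the shortfall of the index of an arm pulled [s] times; the rate [l] is
   tuned to the range [q <= s <= 2q]. *)
Lemma peeling (R : realType) (q s L ell x l : R) :
  0 < q -> q <= s -> s <= 2 * q -> 0 <= L -> L <= ell ->
  l = 2 * Num.sqrt ((L + 1) / q) ->
  x <= expR (- L) / Num.sqrt q *
       expR (l * (s * (x + Num.sqrt (ell / s))) - l ^+ 2 / 8 * s).
Proof.
move=> q0 qs s2q L0 Lell lE.
have s0 : 0 < s by lra.
have l2 : l ^+ 2 = 4 * (L + 1) / q.
  rewrite lE exprMn sqr_sqrtr; last by rewrite divr_ge0 //; lra.
  by rewrite mulrA; congr (_ * _ / _); rewrite -natrX.
have l0 : 0 < l by rewrite lE mulr_gt0 // sqrtr_gt0 divr_gt0 //; lra.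
have sq0 : 0 < Num.sqrt q by rewrite sqrtr_gt0.
have sqq : Num.sqrt q ^+ 2 = q by rewrite sqr_sqrtr // ltW.
have lq : l ^+ 2 * q = 4 * (L + 1) by rewrite l2 divfK // gt_eqF.
have lsq : Num.sqrt q <= l * s.
  rewrite -ler_sqr ?nnegrE ?mulr_ge0 ?ltW // sqq exprMn.
  have : q * q <= s ^+ 2 by rewrite expr2; apply: ler_pM => //; exact: ltW.
  nra.
set z := Num.sqrt (ell / s).
have z0 : 0 <= z by exact: sqrtr_ge0.
have z2 : z ^+ 2 * s = ell.
  by rewrite sqr_sqrtr ?divfK // ?gt_eqF // divr_ge0; lra.
(* The bonus [z] adds at least [2 * L] to the exponent, the quadratic term costs at most [L + 1] and
   the factor [expR (- L)] costs [L], so at least [l * s * x - 1] is left. *)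
have lsz : 2 * L <= l * s * z.
  rewrite -ler_sqr ?nnegrE; [|lra|by rewrite !mulr_ge0 // ltW].
  have -> : (l * s * z) ^+ 2 = l ^+ 2 * s * (z ^+ 2 * s) by ring.
  rewrite z2.
  have : 4 * (L + 1) <= l ^+ 2 * s by rewrite -lq ler_wpM2l // sqr_ge0.
  move=> H; have : 4 * (L + 1) * L <= l ^+ 2 * s * ell by apply: ler_pM => //; lra.
  by nra.
have ls : l ^+ 2 / 8 * s <= L + 1.
  have : l ^+ 2 * s <= l ^+ 2 * (2 * q) by rewrite ler_wpM2l // sqr_ge0.
  by lra.
(* z <= exp (z - 1) at z = l s x *)
have xe : x * (l * s) <= expR (l * s * x - 1).
  by have := expR_ge1Dx (l * s * x - 1); lra.
have [x0|x0] := leP x 0.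
  by apply: (le_trans x0); rewrite mulr_ge0 ?expR_ge0 // divr_ge0 ?expR_ge0 ?sqrtr_ge0.
rewrite mulrAC -expRD ler_pdivlMr //.
apply: le_trans (_ : x * (l * s) <= _); first by rewrite ler_wpM2l // ltW.
apply: le_trans xe _; rewrite ler_expR; lra.
Qed.

(** For positive [K] and [N], minus the logarithm of this weight is the truncated logarithm of the
    MOSS bonus at [2 ^ j.+1] pulls, its least value on the range from [2 ^ j] to [2 ^ j.+1]. It
    serves as [L] in [peeling]. *)
Definition peel_weight (R : realType) (K N j : nat) : R :=
  Num.min 1 (2 * K%:R / N%:R * 2 ^+ j).

Definition peel_rate (R : realType) (K N j : nat) : R :=
  2 * Num.sqrt ((1 - ln (peel_weight R K N j)) / 2 ^+ j).

(** The term of the range containing [s] suffices, by [peeling]; the others are nonnegative. Keeping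
    all of them gives weights and rates that do not depend on the random number of pulls. *)
Lemma lower_confidence_bound (R : realType) (K N s : nat) (x : R) :
  (0 < K)%N -> (0 < s)%N -> (s <= N)%N ->
  x <= \sum_(j < N) peel_weight R K N j / Num.sqrt (2 ^+ j) *
    expR (peel_rate R K N j * (s%:R * (x +
          Num.sqrt (Num.max (ln (N%:R / (K * s)%N%:R)) 0 / s%:R)))
          - peel_rate R K N j ^+ 2 / 8 * s%:R).
Proof.
move=> K0 s0 sN.
have N0 : (0 < N)%N by lia.
have jN : (trunc_log 2 s < N)%N.
  have := trunc_logP (isT : (1 < 2)%N) s0; have := ltn_expl (trunc_log 2 s) (isT : (1 < 2)%N).
  lia.
have w0 j : 0 < peel_weight R K N j.
  by rewrite /peel_weight lt_min ltr01 !mulr_gt0 ?invr_gt0 ?exprn_gt0 ?ltr0n.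
have w1 j : peel_weight R K N j <= 1 by rewrite /peel_weight ge_min lexx.
rewrite (bigD1 (Ordinal jN)) //= ler_wpDr //.
  by apply: sumr_ge0 => j _; rewrite mulr_ge0 ?expR_ge0 // divr_ge0 ?sqrtr_ge0 // ltW.
have {1}-> : peel_weight R K N (trunc_log 2 s) = expR (- - ln (peel_weight R K N (trunc_log 2 s))).
  by rewrite opprK lnK // posrE.
rewrite /peel_rate [1 - _]addrC; apply: peeling (erefl _).
- by rewrite exprn_gt0.
- by rewrite -natrX ler_nat trunc_logP.
- by rewrite -natrX -natrM ler_nat -expnS ltnW // trunc_log_ltn.
- by rewrite oppr_ge0 ln_le0.
rewrite /peel_weight; set q : R := 2 ^+ _.
have sq : s%:R <= 2 * q by rewrite /q -natrX -natrM ler_nat -expnS ltnW // trunc_log_ltn.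
have [Kp Np sp] : [/\ 0 < K%:R :> R, 0 < N%:R :> R & 0 < s%:R :> R] by rewrite !ltr0n.
have qp : 0 < q by rewrite exprn_gt0.
case: (leP 1 (2 * K%:R / N%:R * q)) => w1'; first by rewrite ln1 oppr0 le_max lexx orbT.
rewrite le_max; apply/orP; left.
rewrite -lnV ?posrE ?mulr_gt0 ?invr_gt0 //.
rewrite ler_ln ?posrE ?invr_gt0 ?mulr_gt0 ?invr_gt0 ?natrM ?mulr_gt0 //.
have -> : (2 * K%:R / N%:R * q)^-1 = N%:R / (K%:R * (2 * q)) :> R.
  by field; rewrite !gt_eqF.
rewrite ler_pM2l // lef_pV2 ?posrE ?mulr_gt0 //.
by rewrite ler_pM2l.
Qed.

(** * Adaptive policies and exponential supermartingales *)

Section Bandit.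
Context (R : realType) (I O : finType) (p r : I -> O -> R).
Hypothesis p_dist : forall i, is_dist (p i).
Hypothesis r01 : forall i o, 0 <= r i o <= 1.

Definition mean (i : I) : R := \sum_o p i o * r i o.

Fixpoint bandit_value (pi : seq (I * R) -> I) (n : nat) (h : seq (I * R)) : R :=
  if n is n'.+1 then
    \sum_o p (pi h) o *
      (r (pi h) o + bandit_value pi n' (rcons h (pi h, r (pi h) o)))
  else 0.

Definition total_reward (h : seq (I * R)) (i : I) : R := \sum_(z <- h | z.1 == i) z.2.

Definition deviation (h : seq (I * R)) (i : I) : R :=
  total_reward h i - (pulls h i)%:R * mean i.

(** The parameter [c] is an additional discount per pull: 0 for the best arm, and [gap i ^+ 2 / 8]
    for an arm whose pulls are to be paid for by the decrease. *)
Definition expmart (l c : R) (h : seq (I * R)) (i : I) : R :=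
  expR (l * deviation h i - (l ^+ 2 / 8 + c) * (pulls h i)%:R).

Lemma p_sum i (x : R) : \sum_o p i o * x = x.
Proof. by rewrite -mulr_suml (p_dist i).2 mul1r. Qed.

Lemma mean01 i : 0 <= mean i <= 1.
Proof.
have [p0 _] := p_dist i.
rewrite /mean sumr_ge0 /= => [|o _]; last first.
  by rewrite mulr_ge0 //; have /andP[] := r01 i o.
rewrite -[leRHS](p_sum i 1); apply: ler_sum => o _.
by apply: ler_wpM2l => //; have /andP[] := r01 i o.
Qed.

Lemma pulls_rcons (h : seq (I * R)) i x j :
  pulls (rcons h (i, x)) j = (pulls h j + (i == j))%N.
Proof. by rewrite /pulls -cats1 count_cat /= addn0. Qed.

Lemma pulls_size (h : seq (I * R)) j : (pulls h j <= size h)%N.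
Proof. exact: count_size. Qed.

Lemma total_reward_rcons (h : seq (I * R)) i x j :
  total_reward (rcons h (i, x)) j = total_reward h j + (if i == j then x else 0).
Proof. by rewrite /total_reward -cats1 big_cat big_cons big_nil /=; case: ifP; rewrite ?addr0. Qed.

Lemma expmart_other l c h i j x : i != j ->
  expmart l c (rcons h (i, x)) j = expmart l c h j.
Proof.
by move=> /negPf ij; rewrite /expmart /deviation pulls_rcons total_reward_rcons ij addn0 addr0.
Qed.

(** Hoeffding's lemma compensates the term [l ^+ 2 / 8] of one pull, so only the discount
    [expR (- c)] remains. *)
Lemma expmart_pulled l c h i :
  \sum_o p i o * expmart l c (rcons h (i, r i o)) i <= expR (- c) * expmart l c h i.
Proof.
have e o : expmart l c (rcons h (i, r i o)) i =
    expR (- c) * expmart l c h i * expR (- (l ^+ 2 / 8)) * expR (l * (r i o - mean i)).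
  rewrite /expmart /deviation pulls_rcons total_reward_rcons eqxx addn1 -natr1 -!expRD.
  by congr expR; lra.
under eq_bigr => o _ do rewrite e mulrCA.
rewrite -mulr_sumr.
have H := @hoeffding_lemma R O (p i) (r i) l (mean i) (p_dist i) (r01 i) erefl.
rewrite -[leRHS]mulr1 -mulrA; apply: ler_wpM2l.
  by rewrite mulr_ge0 ?expR_ge0.
apply: le_trans (ler_wpM2l (expR_ge0 _) H) _.
by rewrite -expRD addNr expR0.
Qed.

Lemma expmart_step l h i j :
  \sum_o p i o * expmart l 0 (rcons h (i, r i o)) j <= expmart l 0 h j.
Proof.
have [->|ij] := eqVneq i j.
  by have := expmart_pulled l 0 h j; rewrite oppr0 expR0 mul1r.
by under eq_bigr => o _ do rewrite expmart_other //; rewrite p_sum.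
Qed.

(** Backward induction: the expected drop of the potential pays for the regret of each round.
    Restricting to [size h + n.+1 = N] provides the bound [size h < N] under which [is_moss]
    describes the policy. *)
Lemma regret_le_potential (pi : seq (I * R) -> I) (mu : R) (N : nat)
    (Phi : nat -> seq (I * R) -> R) :
  (forall h, 0 <= Phi 0%N h) ->
  (forall n h, (size h + n.+1)%N = N ->
    mu - mean (pi h) + \sum_o p (pi h) o * Phi n (rcons h (pi h, r (pi h) o))
      <= Phi n.+1 h) ->
  forall n h, (size h + n)%N = N -> n%:R * mu - bandit_value pi n h <= Phi n h.
Proof.
move=> Phi0 PhiS; elim=> [|n IH] h hN /=; first by rewrite mul0r subr0.
apply: le_trans (PhiS n h hN).
have -> : n.+1%:R * mu - \sum_o p (pi h) o * (r (pi h) o +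
      bandit_value pi n (rcons h (pi h, r (pi h) o))) =
  mu - mean (pi h) + \sum_o p (pi h) o * (n%:R * mu -
      bandit_value pi n (rcons h (pi h, r (pi h) o))).
  under eq_bigr => o _ do rewrite mulrDr.
  under [in RHS]eq_bigr => o _ do rewrite mulrBr.
  rewrite big_split sumrB /= p_sum -/(mean _) -natr1; lra.
rewrite lerD2l; apply: ler_sum => o _; apply: ler_wpM2l; first exact: (p_dist _).1.
by apply: IH; rewrite size_rcons addSnnS.
Qed.

(** * The potential argument when there are at least as many rounds as arms *)

Section LongHorizon.
Variables (star : I) (N : nat).
Hypothesis star_best : forall i, mean i <= mean star.
Hypothesis IN : (#|I| <= N)%N.

Definition gap (i : I) : R := mean star - mean i.

(* Gaps below [1 / rho] cost at most [sqrt (#|I| N)] over [N] rounds. *)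
Definition rho : R := Num.sqrt (#|I| * N)%N%:R / #|I|%:R.

(** The rates are negated because the index of the best arm falls short through negative
    deviations. *)
Definition star_cost (h : seq (I * R)) : R :=
  \sum_(j < N) peel_weight R #|I| N j / Num.sqrt (2 ^+ j) *
    expmart (- peel_rate R #|I| N j) 0 h star.

(** The indicator covers the pulls made while the bonus may still be large; after that, the
    exponential is at least 1 whenever the index is overestimated. Arms of gap below [rho^-1] are
    charged nothing. *)
Definition arm_cost (h : seq (I * R)) (i : I) : R :=
  if 1 <= rho * gap i then
    gap i * (((pulls h i)%:R * gap i < 4 * rho)%R%:R
             + expmart (gap i) (gap i ^+ 2 / 8) h i)
  else 0.

(* Pays one [gap i] for each of the first [4 * rho / gap i] pulls; the factor of
   the exponential is at least [1 / (1 - expR (- c))], [c = gap i ^+ 2 / 8]. *)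
Definition arm_potential (h : seq (I * R)) (i : I) : R :=
  if 1 <= rho * gap i then
    gap i * (Num.max 0 (4 * rho / gap i + 1 - (pulls h i)%:R)
             + (1 + 8 / gap i ^+ 2) * expmart (gap i) (gap i ^+ 2 / 8) h i)
  else 0.

Lemma K_gt0 : (0 < #|I|)%N.
Proof. by apply/card_gt0P; exists star. Qed.

Lemma N_gt0 : (0 < N)%N.
Proof. exact: leq_trans K_gt0 IN. Qed.

Lemma rho_gt0 : 0 < rho.
Proof. by rewrite divr_gt0 ?sqrtr_gt0 ?ltr0n ?muln_gt0 ?K_gt0 ?N_gt0. Qed.

Lemma rho_sqr : rho ^+ 2 = N%:R / #|I|%:R.
Proof.
have K0 : 0 < #|I|%:R :> R by rewrite ltr0n K_gt0.
rewrite /rho expr_div_n sqr_sqrtr ?ler0n // natrM; field; rewrite gt_eqF //.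
Qed.

Lemma expmart_ge0 l c h i : 0 <= expmart l c h i.
Proof. exact: expR_ge0. Qed.

Lemma gap_ge0 i : 0 <= gap i.
Proof. by rewrite subr_ge0. Qed.

Lemma peel_weight_ge0 j : 0 <= peel_weight R #|I| N j.
Proof.
by rewrite /peel_weight le_min ler01 !mulr_ge0 ?invr_ge0 ?exprn_ge0 ?ler0n.
Qed.

Lemma star_cost_ge0 h : 0 <= star_cost h.
Proof.
apply: sumr_ge0 => j _; rewrite mulr_ge0 ?expmart_ge0 //.
by rewrite divr_ge0 ?peel_weight_ge0 ?sqrtr_ge0.
Qed.

Lemma arm_cost_ge0 h i : 0 <= arm_cost h i.
Proof.
rewrite /arm_cost; case: ifP => // _.
by rewrite mulr_ge0 ?gap_ge0 // addr_ge0 ?expmart_ge0 ?ler0n.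
Qed.

Lemma arm_potential_ge0 h i : 0 <= arm_potential h i.
Proof.
rewrite /arm_potential; case: ifP => // _.
rewrite mulr_ge0 ?gap_ge0 // addr_ge0 //; first by rewrite le_max lexx.
by rewrite mulr_ge0 ?expmart_ge0 // addr_ge0 // divr_ge0 // sqr_ge0.
Qed.

Lemma star_cost_ge (h : seq (I * R)) : (0 < pulls h star)%N -> (pulls h star <= N)%N ->
  mean star - moss_index N h star <= star_cost h.
Proof.
move=> s0 sN.
apply: le_trans (lower_confidence_bound _ K_gt0 s0 sN) _.
rewrite le_eqVlt; apply/orP; left; apply/eqP; apply: eq_bigr => j _.
congr (_ * expR _); rewrite /moss_index /deviation -/(total_reward h star).
have sp : (pulls h star)%:R != 0 :> R by rewrite pnatr_eq0 -lt0n.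
rewrite sqrrN addr0 opprD addrA subrK mulrBr mulrCA divff // mulr1.
by rewrite mulNr -mulrN opprB.
Qed.

(** After [4 * rho / gap i] pulls, [ln x <= x] bounds the bonus by [gap i / 4]. The average reward
    then exceeds the mean by at least [gap i / 4], which makes the exponent of [expmart]
    nonnegative. *)
Lemma arm_cost_ge (h : seq (I * R)) (i : I) :
  1 <= rho * gap i -> mean i + gap i / 2 <= moss_index N h i ->
  gap i <= arm_cost h i.
Proof.
move=> big ind; rewrite /arm_cost big; have g0 := gap_ge0 i.
have rp := rho_gt0.
have gp : 0 < gap i by nra.
rewrite ler_peMr //; case: ltP => [_|sg]; first by rewrite lerDl expmart_ge0.
rewrite add0r -[leLHS]expR0 ler_expR.
have Kp : 0 < #|I|%:R :> R by rewrite ltr0n K_gt0.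
have Np : 0 < N%:R :> R by rewrite ltr0n N_gt0.
have sp : 0 < (pulls h i)%:R :> R.
  rewrite ltr0n lt0n; apply/eqP => s0; move: sg; rewrite s0; nra.
rewrite /deviation; move: ind; rewrite /moss_index -/(total_reward h i).
rewrite natrM; set s : R := (pulls h i)%:R.
have lnle : Num.max (ln (N%:R / (#|I|%:R * s))) 0 <= s * (gap i / 4) ^+ 2.
  have rhs0 : 0 <= s * (gap i / 4) ^+ 2 by rewrite mulr_ge0 ?sqr_ge0 // ltW.
  rewrite ge_max rhs0 andbT.
  have x0 : 0 < N%:R / (#|I|%:R * s) by rewrite divr_gt0 ?mulr_gt0.
  apply: le_trans (ltW (ln_sublinear x0)) _.
  have -> : N%:R / (#|I|%:R * s) = rho ^+ 2 / s.
    by rewrite rho_sqr invfM mulrA.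
  rewrite ler_pdivrMr //.
  have : (4 * rho) * (4 * rho) <= s * gap i * (s * gap i).
    by apply: ler_pM => //; lra.
  nra.
have : Num.sqrt (Num.max (ln (N%:R / (#|I|%:R * s))) 0 / s) <= gap i / 4.
  rewrite -[leRHS]ger0_norm; last by lra.
  by rewrite -sqrtr_sqr; apply: ler_wsqrtr; rewrite ler_pdivrMr // [leRHS]mulrC.
move=> bonus ind.
have : s * (mean i + gap i / 4) <= total_reward h i.
  by rewrite mulrC -ler_pdivlMr //; lra.
by rewrite -(ler_pM2l gp); lra.
Qed.

(** For a large gap and many pulls, either the index of the best arm falls short of its mean by half
    the gap, or the chosen index, being maximal, exceeds its own mean by half the gap. *)
Lemma moss_choice (pi : seq (I * R) -> I) (h : seq (I * R)) :
  is_moss N pi -> (size h < N)%N ->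
  gap (pi h) <= rho^-1 + 2 * star_cost h + arm_cost h (pi h).
Proof.
move=> moss hN; have [explore exploit] := moss h hN.
have rp := rho_gt0; have ri : 0 < rho^-1 by rewrite invr_gt0.
have sc := star_cost_ge0 h; have ac := arm_cost_ge0 h (pi h).
have g0 := gap_ge0 (pi h).
have [small|big] := ltP (rho * gap (pi h)) 1.
  have : gap (pi h) <= rho^-1 by rewrite -[leRHS]mulr1 ler_pdivlMl // ltW.
  lra.
have [few|many] := ltP ((pulls h (pi h))%:R * gap (pi h)) (4 * rho).
  have : gap (pi h) <= arm_cost h (pi h).
    rewrite /arm_cost big few ler_peMr // lerDl; exact: expmart_ge0.
  lra.
(* If some arm were unpulled, the chosen arm would be unpulled too, contradicting [many]. *)
have pulled i : (0 < pulls h i)%N.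
  rewrite lt0n; apply/eqP => i0; move: many.
  rewrite explore; last by exists i.
  lra.
have [low|high] := leP (gap (pi h) / 2) (mean star - moss_index N h star).
  have := star_cost_ge (pulled star) (leq_trans (pulls_size h star) (ltnW hN)).
  lra.
have : gap (pi h) <= arm_cost h (pi h).
  apply: arm_cost_ge => //; have := exploit pulled star.
  rewrite /gap in high *; lra.
lra.
Qed.

Lemma star_cost_step h i :
  \sum_o p i o * star_cost (rcons h (i, r i o)) <= star_cost h.
Proof.
under eq_bigr => o _ do rewrite mulr_sumr.
rewrite exchange_big; apply: ler_sum => j _ /=.
under eq_bigr => o _ do rewrite mulrCA.
rewrite -mulr_sumr ler_wpM2l ?divr_ge0 ?peel_weight_ge0 ?sqrtr_ge0 //.
exact: expmart_step.
Qed.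

Lemma arm_potential_step h i :
  \sum_o p i o * arm_potential (rcons h (i, r i o)) i + arm_cost h i
    <= arm_potential h i.
Proof.
rewrite /arm_potential /arm_cost; case: ifP => [big|_]; last first.
  by rewrite big1 ?addr0 // => o _; rewrite mulr0.
have rp := rho_gt0; have g0 := gap_ge0 i.
have gp : 0 < gap i by nra.
under eq_bigr => o _ do rewrite mulrCA mulrDr (mulrCA (p i o)).
rewrite -mulr_sumr -mulrDr ler_pM2l // big_split /= -mulr_sumr.
set c := gap i ^+ 2 / 8.
have c0 : 0 < c by rewrite divr_gt0 ?exprn_gt0.
have -> : 8 / gap i ^+ 2 = c^-1 by rewrite /c invf_div.
have := expmart_pulled (gap i) c h i.
move=> Xle.
(* One pull divides the expected exponential by at least [1 + c]. With the factor [1 + c^-1], the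
   drop is thus at least the current value of the exponential. *)
have emax : expR (- c) * (1 + c) <= 1.
  by rewrite -[leRHS](expRxMexpNx_1 c) mulrC ler_wpM2r ?expR_ge0 // expR_ge1Dx.
have Y0 := expmart_ge0 (gap i) c h i.
move: Xle; set X := (\sum_o _ * expmart _ _ _ _) => Xle.
have XY : (1 + c^-1) * X + expmart (gap i) c h i <= (1 + c^-1) * expmart (gap i) c h i.
  have : X * (1 + c) <= expmart (gap i) c h i.
    apply: le_trans (_ : expR (- c) * expmart (gap i) c h i * (1 + c) <= _).
      by rewrite ler_wpM2r //; lra.
    by rewrite mulrAC ler_piMl.
  move=> XY; rewrite -(ler_pM2l c0).
  have -> : c * ((1 + c^-1) * X + expmart (gap i) c h i) =
    X * (1 + c) + c * expmart (gap i) c h i by field; rewrite gt_eqF.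
  have -> : c * ((1 + c^-1) * expmart (gap i) c h i) =
    expmart (gap i) c h i + c * expmart (gap i) c h i by field; rewrite gt_eqF.
  by rewrite lerD2r.
under eq_bigr => o _ do rewrite pulls_rcons eqxx natrD.
rewrite p_sum.
set s : R := (pulls h i)%:R; set x := 4 * rho / gap i.
(* The [+ 1] in the counter makes it drop by a full unit even at the last pull with [s < x], where
   [x - s] may be below 1. *)
have : Num.max 0 (x + 1 - (s + 1)) + (s * gap i < 4 * rho)%R%:R <= Num.max 0 (x + 1 - s).
  rewrite -ltr_pdivlMr // -/x.
  case: (ltP s x) => sx /=; last by rewrite addr0 ge_max !le_max lexx; lra.
  by rewrite !max_r; lra.
lra.
Qed.

Lemma arm_potential_other h i j : i != j ->
  \sum_o p i o * arm_potential (rcons h (i, r i o)) j = arm_potential h j.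
Proof.
move=> ij; rewrite -[RHS](p_sum i); apply: eq_bigr => o _.
rewrite /arm_potential expmart_other // pulls_rcons.
by rewrite (negPf ij) addn0.
Qed.

(** Since [star_cost] is a supermartingale, its current value can stand for its value in each of the
    [n] remaining rounds. *)
Definition potential (n : nat) (h : seq (I * R)) : R :=
  n%:R * (rho^-1 + 2 * star_cost h) + \sum_i arm_potential h i.

Lemma potential_step (pi : seq (I * R) -> I) n h :
  is_moss N pi -> (size h < N)%N ->
  mean star - mean (pi h) +
    \sum_o p (pi h) o * potential n (rcons h (pi h, r (pi h) o))
  <= potential n.+1 h.
Proof.
move=> moss hN; have := moss_choice moss hN.
set i := pi h; rewrite /gap => choice.
have -> : \sum_o p i o * potential n (rcons h (i, r i o)) =
    n%:R * (rho^-1 + 2 * \sum_o p i o * star_cost (rcons h (i, r i o))) +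
    \sum_j \sum_o p i o * arm_potential (rcons h (i, r i o)) j.
  have e o : p i o * potential n (rcons h (i, r i o)) =
      n%:R * (p i o * rho^-1 + 2 * (p i o * star_cost (rcons h (i, r i o)))) +
      \sum_j p i o * arm_potential (rcons h (i, r i o)) j.
    rewrite -mulr_sumr /potential; ring.
  under eq_bigr => o _ do rewrite e.
  by rewrite big_split exchange_big /= -mulr_sumr big_split /= p_sum -mulr_sumr.
rewrite (bigD1 i) //= /potential (bigD1 i _ (F := arm_potential h)) //=.
have -> : \sum_(j | j != i) \sum_o p i o * arm_potential (rcons h (i, r i o)) j =
    \sum_(j | j != i) arm_potential h j.
  by apply: eq_bigr => j ji; rewrite arm_potential_other // eq_sym.
have := arm_potential_step h i.
have : n%:R * (2 * \sum_o p i o * star_cost (rcons h (i, r i o))) <= n%:R * (2 * star_cost h).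
  by rewrite ler_wpM2l ?ler0n // ler_pM2l // star_cost_step.
rewrite -natr1; lra.
Qed.

(** All exponentials are 1 at the start. With [Q] the square root, the rounds contribute [Q] through
    [rho^-1] and at most [39 * Q] through [star_cost], and the arms at most
    [12 * Q + 2 * #|I| <= 14 * Q]. *)
Lemma potential_nil : potential N [::] <= 55 * Num.sqrt (#|I| * N)%N%:R.
Proof.
have rp := rho_gt0.
have Kp : 0 < #|I|%:R :> R by rewrite ltr0n K_gt0.
have Np : 0 < N%:R :> R by rewrite ltr0n N_gt0.
have KN : #|I|%:R <= N%:R :> R by rewrite ler_nat.
set Q := Num.sqrt _.
have Q0 : 0 <= Q by exact: sqrtr_ge0.
have Q2 : Q ^+ 2 = #|I|%:R * N%:R by rewrite sqr_sqrtr ?ler0n // natrM.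
have KQ : #|I|%:R <= Q by rewrite -ler_sqr ?nnegrE ?ler0n // Q2 expr2 ler_pM2l.
have rK : rho * #|I|%:R = Q by rewrite /rho divfK // gt_eqF.
have Nr : N%:R * rho^-1 = Q.
  by rewrite -[RHS](mulfK (lt0r_neq0 rp)); congr (_ / _); nra.
have sc : N%:R * star_cost [::] <= 39 / 2 * Q.
  have em l c i : expmart l c [::] i = 1.
    by rewrite /expmart /deviation /total_reward /pulls big_nil /= !(mul0r, mulr0, subr0) expR0.
  have a0 : 0 < 2 * #|I|%:R / N%:R :> R by rewrite divr_gt0 ?mulr_gt0.
  have := dyadic_sum N a0.
  have -> : \sum_(j < N) Num.min 1 (2 * #|I|%:R / N%:R * 2 ^+ j) / Num.sqrt (2 ^+ j) =
      star_cost [::].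
    by apply: eq_bigr => j _; rewrite em mulr1.
  (* The left side is [Num.sqrt 2 * Q]; the factor 13 of [dyadic_sum] then yields [39 / 2]. *)
  have : N%:R * Num.sqrt (2 * #|I|%:R / N%:R) <= 3 / 2 * Q.
    rewrite -ler_sqr ?nnegrE; last 2 first.
    - by rewrite mulr_ge0 ?sqrtr_ge0 ?ler0n.
    - by rewrite mulr_ge0 // divr_ge0.
    rewrite !exprMn Q2 sqr_sqrtr; last exact: ltW.
    have -> : N%:R ^+ 2 * (2 * #|I|%:R / N%:R) = 2 * (#|I|%:R * N%:R) :> R.
      by field; rewrite gt_eqF.
    have : 0 < #|I|%:R * N%:R :> R by rewrite mulr_gt0.
    lra.
  move=> H1 H2; have := ler_wpM2l (ltW Np) H2; lra.
have ap i : arm_potential [::] i <= 12 * rho + 2.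
  rewrite /arm_potential; case: ifP => big; last by lra.
  have g0 := gap_ge0 i; have gp : 0 < gap i by nra.
  rewrite /expmart /deviation /total_reward /pulls big_nil /= !(mul0r, mulr0, subr0) expR0 mulr1.
  have x0 : 0 <= 4 * rho / gap i by rewrite divr_ge0 //; lra.
  rewrite max_r; last by lra.
  have -> : gap i * (4 * rho / gap i + 1 + (1 + 8 / gap i ^+ 2)) =
    4 * rho + 2 * gap i + 8 / gap i by field; rewrite gt_eqF.
  have : 1 / gap i <= rho by rewrite ler_pdivrMr.
  have : gap i <= 1.
    by rewrite /gap; have := mean01 i; have := mean01 star; lra.
  lra.
have : \sum_i arm_potential [::] i <= #|I|%:R * (12 * rho + 2).
  apply: le_trans (ler_sum _ (fun i _ => ap i)) _.
  by rewrite sumr_const [leRHS]mulr_natl.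
move=> aps; rewrite /potential mulrDr Nr; lra.
Qed.

Lemma moss_regret_long_horizon (pi : seq (I * R) -> I) : is_moss N pi ->
  N%:R * mean star - bandit_value pi N [::] <= 55 * Num.sqrt (#|I| * N)%N%:R.
Proof.
move=> moss; apply: le_trans potential_nil.
apply: (@regret_le_potential pi (mean star) N potential) => //.
  move=> h; rewrite /potential mul0r add0r sumr_ge0 // => i _.
  exact: arm_potential_ge0.
by move=> n h hN; apply: potential_step => //; rewrite -[ltnRHS]hN addnS ltnS leq_addr.
Qed.
End LongHorizon.

(** With fewer rounds than arms, a regret of at most 1 per round is enough, as [N] is then at most
    the square root of [#|I| * N]. *)
Lemma moss_regret (star : I) (N : nat) (pi : seq (I * R) -> I) :
  (forall i, mean i <= mean star) -> is_moss N pi ->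
  N%:R * mean star - bandit_value pi N [::] <= 55 * Num.sqrt (#|I| * N)%N%:R.
Proof.
move=> best moss; have [IN|NI] := leqP #|I| N.
  exact: moss_regret_long_horizon.
have NQ : N%:R <= Num.sqrt (#|I| * N)%N%:R :> R.
  rewrite -ler_sqr ?nnegrE ?sqrtr_ge0 ?ler0n // sqr_sqrtr ?ler0n // -natrX ler_nat.
  by rewrite leq_mul2r ltnW ?orbT.
apply: (@le_trans _ _ N%:R); last by have := ler0n R N; lra.
apply: (@regret_le_potential pi _ N (fun n _ => n%:R)) => // n h _.
rewrite p_sum // -natr1; have := mean01 (pi h); have := mean01 star; lra.
Qed.
End Bandit.

(** * The repeated game *)

Lemma big_tuple_cons (R : realType) (B : finType) (n : nat)
    (F : n.+1.-tuple B -> R) :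
  \sum_(bs : n.+1.-tuple B) F bs = \sum_b \sum_(bs : n.-tuple B) F [tuple of b :: bs].
Proof.
rewrite pair_big (reindex (fun z : B * n.-tuple B => [tuple of z.1 :: z.2])) //=.
exists (fun bs => (thead bs, [tuple of behead bs])) => [[b bs]|bs] _ /=.
  by congr pair; apply: val_inj.
by rewrite [RHS]tuple_eta; apply: val_inj.
Qed.

Lemma big_tuple_nil (R : realType) (B : finType) (F : 0.-tuple B -> R) :
  \sum_(bs : 0.-tuple B) F bs = F [tuple].
Proof.
rewrite (big_pred1 [tuple]) // => bs.
by apply/esym/eqP; rewrite tuple0.
Qed.

Lemma sum_product_measure (R : realType) (B : finType) (n : nat)
    (q : nat -> B -> R) :
  (forall t, is_dist (q t)) ->
  \sum_(bs : n.-tuple B) \prod_(t < n) q t (tnth bs t) = 1.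
Proof.
elim: n q => [|n IH] q q_dist; first by rewrite big_tuple_nil big_ord0.
rewrite big_tuple_cons -[RHS](q_dist 0%N).2; apply: eq_bigr => b _.
rewrite -[RHS]mulr1 -[X in _ = _ * X](IH (fun t => q t.+1)) // mulr_sumr.
apply: eq_bigr => bs _; rewrite big_ord_recl tnth0; congr (_ * _).
by apply: eq_bigr => t _; rewrite tnthS.
Qed.

Lemma expected_sum_product_measure (R : realType) (B : finType) (n : nat)
    (q v : nat -> B -> R) :
  (forall t, is_dist (q t)) ->
  \sum_(bs : n.-tuple B) (\prod_(t < n) q t (tnth bs t)) *
      (\sum_(t < n) v t (tnth bs t)) =
  \sum_(t < n) \sum_b q t b * v t b.
Proof.
elim: n q v => [|n IH] q v q_dist; first by rewrite big_tuple_nil !big_ord0 mulr0.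
pose P (bs : n.-tuple B) := \prod_(t < n) q t.+1 (tnth bs t).
have e b (bs : n.-tuple B) :
    (\prod_(t < n.+1) q t (tnth [tuple of b :: bs] t)) *
      (\sum_(t < n.+1) v t (tnth [tuple of b :: bs] t)) =
    q 0%N b * v 0%N b * P bs + q 0%N b * (P bs * \sum_(t < n) v t.+1 (tnth bs t)).
  rewrite !big_ord_recl tnth0 /P.
  under eq_bigr => t _ do rewrite tnthS.
  under [X in _ * (_ + X)]eq_bigr => t _ do rewrite tnthS.
  by rewrite mulrDr; congr (_ + _); [rewrite mulrAC | rewrite mulrA].
rewrite big_tuple_cons big_ord_recl /= -(IH (fun t => q t.+1) (fun t => v t.+1)) //.
rewrite -[X in _ + X]mul1r -[X in _ + X * _](q_dist 0%N).2 mulr_suml -big_split /=.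
apply: eq_bigr => b _; under eq_bigr => bs _ do rewrite e.
rewrite big_split /= -!mulr_sumr; congr (_ + _).
by rewrite (@sum_product_measure _ _ _ (fun t => q t.+1)) // mulr1.
Qed.

Lemma size_counts (A : finType) (s : seq A) : (\sum_a counts s a)%N = size s.
Proof.
under eq_bigr => a _ do rewrite ffunE.
elim: s => [|x s IH] /=; first by rewrite big1.
rewrite big_split /= IH (bigD1 x) //= eqxx big1 ?addn0 // => a /negPf ax.
by rewrite eq_sym ax.
Qed.

Lemma size_recent (X : Type) (m : nat) (s : seq X) : (size (recent m s) <= m)%N.
Proof. by rewrite size_drop; lia. Qed.

Lemma recent_cat (X : Type) (m : nat) (r s : seq X) :
  (m <= size s)%N -> recent m (r ++ s) = recent m s.
Proof.
move=> ms; rewrite /recent size_cat drop_cat ltnNge.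
have -> : (size r <= size r + size s - m)%N by lia.
by congr drop; lia.
Qed.

(** * Payoffs against a rule of bounded memory *)

Section Rounds.
Context (R : realType) (A B : finType) (u : A -> B -> R) (m : nat).
Context (f : {ffun A -> nat} -> B -> R).
Hypothesis rule : is_rule m f.
Hypothesis u01 : forall a b, 0 <= u a b <= 1.

Definition reply (s : seq A) : B -> R := f (counts (recent m s)).

Lemma reply_dist s : is_dist (reply s).
Proof. by apply: rule; rewrite size_counts size_recent. Qed.

Lemma reply_cat r s : (m <= size s)%N -> reply (r ++ s) = reply s.
Proof. by move=> ms; rewrite /reply recent_cat. Qed.

Lemma reply_sum s (x : R) : \sum_b reply s b * x = x.
Proof. by rewrite -mulr_suml (reply_dist s).2 mul1r. Qed.

Fixpoint value_to_go (sigma : seq (A * B) -> A) (n : nat) (h : seq (A * B)) : R :=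
  if n is n'.+1 then
    \sum_b reply [seq z.1 | z <- h] b *
      (u (sigma h) b + value_to_go sigma n' (rcons h (sigma h, b)))
  else 0.

Definition play_from (sigma : seq (A * B) -> A) (h : seq (A * B)) (bs : seq B) :=
  foldl (fun h b => rcons h (sigma h, b)) h bs.

Lemma play_from_prefix sigma h bs :
  exists2 h', play_from sigma h bs = h ++ h' & size h' = size bs.
Proof.
elim: bs h => [|b bs IH] h /=; first by exists [::]; rewrite ?cats0.
have [h' -> <-] := IH (rcons h (sigma h, b)).
by exists ((sigma h, b) :: h'); rewrite ?cat_rcons.
Qed.

(* The constant [x] makes the induction go through without a separate proof that
   the probabilities of the plays sum to 1. *)
Lemma value_to_go_unfold sigma a n h x :
  x + value_to_go sigma (a + n) h =
  \sum_(bs : a.-tuple B)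
    (\prod_(t < a) reply [seq z.1 | z <- take (size h + t) (play_from sigma h bs)]
                     (tnth bs t)) *
    (x + \sum_(z <- drop (size h) (play_from sigma h bs)) u z.1 z.2 +
     value_to_go sigma n (play_from sigma h bs)).
Proof.
elim: a h x => [|a IH] h x.
  by rewrite big_tuple_nil big_ord0 mul1r /= drop_size big_nil addr0.
rewrite big_tuple_cons /= -{1}(reply_sum [seq z.1 | z <- h] x) -big_split /=.
apply: eq_bigr => b _; rewrite -mulrDr addrA IH mulr_sumr.
apply: eq_bigr => bs _; rewrite big_ord_recl tnth0 addn0 mulrA /=.
have [h' -> _] := play_from_prefix sigma (rcons h (sigma h, b)) bs.
have -> : take (size h) (rcons h (sigma h, b) ++ h') = h.
  by rewrite cat_rcons take_size_cat.
have -> : drop (size h) (rcons h (sigma h, b) ++ h') = (sigma h, b) :: h'.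
  by rewrite cat_rcons drop_size_cat.
rewrite (drop_size_cat _ (erefl (size (rcons h (sigma h, b))))) big_cons.
rewrite [in RHS]addrA; congr (_ * _ * _); apply: eq_bigr => t _.
by rewrite tnthS size_rcons addSnnS.
Qed.

Lemma value_to_go_ge0 sigma n h : 0 <= value_to_go sigma n h.
Proof.
elim: n h => [|n IH] h //=; apply: sumr_ge0 => b _; apply: mulr_ge0.
  exact: (reply_dist _).1.
by apply: addr_ge0 => //; case/andP: (u01 (sigma h) b).
Qed.

(** The payoffs of the first [a] rounds are nonnegative and are dropped. Applied to the first half
    of each block, this is where the factor 1/2 is lost. *)
Lemma value_to_go_ge sigma a n h c :
  (forall bs, size bs = a -> c <= value_to_go sigma n (play_from sigma h bs)) ->
  c <= value_to_go sigma (a + n) h.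
Proof.
elim: a h => [|a IH] h cle; first exact: (cle [::]).
rewrite /= -(reply_sum [seq z.1 | z <- h] c); apply: ler_sum => b _.
apply: ler_wpM2l; first exact: (reply_dist _).1.
have /andP[u0 _] := u01 (sigma h) b.
apply: le_trans (_ : value_to_go sigma (a + n) (rcons h (sigma h, b)) <= _); last by lra.
by apply: IH => bs sz; apply: (cle (b :: bs)); rewrite /= sz.
Qed.

Lemma strategy_payoffE sigma T :
  strategy_payoff u m f sigma T = value_to_go sigma T [::].
Proof.
rewrite -[RHS]add0r -[X in value_to_go _ X]addn0 value_to_go_unfold.
by apply: eq_bigr => bs _; rewrite drop0 addr0 add0r.
Qed.

(** Plain sequences with a default action allow rounds of concatenations and windows to be compared
    without casts between tuple lengths. *)
Definition payoff_at (a0 : A) (s : seq A) (t : nat) : R :=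
  mean_payoff u (nth a0 s t) (reply (take t s)).

Lemma round_payoff_at a0 n (x : n.-tuple A) (t : 'I_n) :
  round_payoff u m f x t = payoff_at a0 x t.
Proof. by rewrite /round_payoff (tnth_nth a0). Qed.

Lemma payoff_at_ge0 a0 s t : 0 <= payoff_at a0 s t.
Proof.
apply: sumr_ge0 => b _; rewrite mulr_ge0 ?(reply_dist _).1 //.
by case/andP: (u01 (nth a0 s t) b).
Qed.

Lemma payoff_at_le1 a0 s t : payoff_at a0 s t <= 1.
Proof.
rewrite -[leRHS](reply_sum (take t s)); apply: ler_sum => b _.
by rewrite ler_wpM2l ?(reply_dist _).1 //; case/andP: (u01 (nth a0 s t) b).
Qed.

Lemma payoff_at_catl a0 s r t :
  (t < size s)%N -> payoff_at a0 (s ++ r) t = payoff_at a0 s t.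
Proof. by move=> ts; rewrite /payoff_at nth_cat ts take_cat ts. Qed.

(** After [m] rounds of [s] the memory contains actions of [s] only. *)
Lemma payoff_at_catr a0 r s t : (m <= t)%N -> (t < size s)%N ->
  payoff_at a0 (r ++ s) (size r + t) = payoff_at a0 s t.
Proof.
move=> mt ts; rewrite /payoff_at nth_cat take_cat ltnNge leq_addr addKn.
by rewrite reply_cat // size_takel // ltnW.
Qed.

Lemma last_m_payoff_at a0 (x : (2 * m).-tuple A) :
  last_m_payoff u f x = \sum_(t < m) payoff_at a0 x (m + t).
Proof.
rewrite /last_m_payoff; under eq_bigr => t _ do rewrite (round_payoff_at a0).
rewrite -(big_mkord (fun t => m <= t)%N (payoff_at a0 x)).
rewrite -(big_mkord xpredT (fun t => payoff_at a0 x (m + t))).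
rewrite (big_cat_nat (n := m)) //=; last by lia.
rewrite big_nat_cond big_pred0 ?add0r => [|t]; last by lia.
rewrite -{1}[m]add0n big_addn.
have -> : (2 * m - m = m)%N by lia.
by apply: eq_big => [t|t _]; [rewrite leq_addl | rewrite addnC].
Qed.

Lemma last_m_payoff_ge0 (x : (2 * m).-tuple A) : 0 <= last_m_payoff u f x.
Proof.
apply: sumr_ge0 => t _; rewrite (round_payoff_at (tnth x t)); exact: payoff_at_ge0.
Qed.

Lemma last_m_payoff_le (x : (2 * m).-tuple A) : last_m_payoff u f x <= m%:R.
Proof.
have [m0|m0] := posnP m.
  by rewrite /last_m_payoff big1 ?ler0n // => t; have := ltn_ord t; lia.
have t0 : 'I_(2 * m) by apply: (Ordinal (n := 2 * m) (m := 0)); lia.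
rewrite (last_m_payoff_at (tnth x t0)) -[m in leRHS]card_ord -sumr_const.
by apply: ler_sum => t _; exact: payoff_at_le1.
Qed.

(** Each window of [m] rounds, joined to the [m] rounds before it, is a block of length [2 * m]; the
    payoff of its second half depends on this block alone. *)
Lemma windows_le a0 (V : R) (y : seq A) n :
  (forall x : (2 * m).-tuple A, last_m_payoff u f x <= V) ->
  (n * m + m <= size y)%N ->
  \sum_(0 <= t < n * m) payoff_at a0 y (m + t) <= n%:R * V.
Proof.
move=> best; elim: n => [|n IH] sz; first by rewrite big_geq // mul0r.
rewrite (big_cat_nat (n := (n * m)%N)) //=; last by lia.
rewrite -natr1 mulrDl mul1r; apply: lerD; first by apply: IH; lia.
have zsz : size (take (2 * m) (drop (n * m) y)) == (2 * m)%N.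
  by rewrite size_takel // size_drop; lia.
apply: le_trans (best (Tuple zsz)); rewrite (last_m_payoff_at a0) /=.
rewrite -{1}[(n * m)%N]add0n big_addn mulSn addnK big_mkord.
apply: ler_sum => t _; rewrite le_eqVlt; apply/orP; left; apply/eqP.
have tm := ltn_ord t.
rewrite -{1}(cat_take_drop (n * m) y) -{1}(cat_take_drop (2 * m) (drop (n * m) y)).
have -> : (m + (t + n * m) = size (take (n * m) y) + (m + t))%N.
  by rewrite size_takel; lia.
rewrite payoff_at_catr ?payoff_at_catl ?cat_take_drop //; rewrite ?(eqP zsz) ?size_drop; lia.
Qed.

(** From round [m] of [s] on, the blanks are forgotten; before that, the memory holds [m - t] blanks
    followed by the first [t] actions of [s], which is the case covered by the blank property. *)
Lemma payoff_at_padded blank s t :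
  (forall s', (size s' <= m)%N ->
     f (counts (nseq (m - size s') blank ++ s')) =1 f (counts s')) ->
  (t < size s)%N ->
  payoff_at blank (nseq m blank ++ s) (m + t) = payoff_at blank s t.
Proof.
move=> fblank ts; rewrite /payoff_at nth_cat take_cat !size_nseq ltnNge leq_addr addKn /=.
apply: eq_bigr => b _; congr (_ * _).
have [mt|tm] := leqP m t; first by rewrite reply_cat // size_takel // ltnW.
have szt : size (take t s) = t by rewrite size_takel // ltnW.
rewrite /reply /recent size_cat size_nseq szt drop_cat size_nseq.
have -> : (t - m = 0)%N by lia.
rewrite drop0 addKn tm -[RHS](fblank (take t s)) szt; last exact: ltnW.
by rewrite drop_nseq.
Qed.

Lemma opt_le blank (V : R) T : (0 < m)%N ->
  (forall s', (size s' <= m)%N ->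
     f (counts (nseq (m - size s') blank ++ s')) =1 f (counts s')) ->
  (forall x : (2 * m).-tuple A, last_m_payoff u f x <= V) ->
  opt u m f T <= (T %/ m).+1%:R * V.
Proof.
move=> m0 fblank best.
(* This handles the default value 0 of the maximum in [opt]; the all-blank block is the witness. *)
have V0 : 0 <= V.
  exact: le_trans (last_m_payoff_ge0 [tuple blank | _ < 2 * m]) (best _).
rewrite /opt; elim/big_ind: _ => [|x y xV yV|x _]; first by rewrite mulr_ge0.
  by rewrite ge_max xV.
(* The blanks in front give the first window its preceding [m] rounds; those behind complete the
   last window. *)
pose y := nseq m blank ++ x ++ nseq m blank.
have divT := divn_eq T m; have modT := ltn_pmod T m0.
have sz : ((T %/ m).+1 * m + m <= size y)%N.
  by rewrite !size_cat !size_nseq size_tuple; lia.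
apply: le_trans (windows_le blank best sz).
have TV : (T <= (T %/ m).+1 * m)%N by lia.
rewrite (big_cat_nat (n := T)) //= ler_wpDr ?sumr_ge0 // => [t _|].
  exact: payoff_at_ge0.
rewrite big_mkord; apply: ler_sum => t _.
rewrite (round_payoff_at blank) /y payoff_at_padded ?payoff_at_catl //.
  by rewrite size_tuple.
by rewrite size_cat size_tuple ltn_addr.
Qed.

(** * The blocks of the algorithm as pulls of a bandit *)

Context (I : finType) (T : nat) (S : I -> (2 * m).-tuple A).
Context (pi : seq (I * R) -> I) (rest : seq (A * B) -> A).
Hypothesis m_gt0 : (0 < m)%N.

Let alg := @unknown_opponent_alg R A B I u m T S pi rest.
Let history := bandit_history u m pi.

Lemma bandit_history_cat h r k :
  (k * (2 * m) <= size h)%N -> history (h ++ r) k = history h k.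
Proof.
elim: k => //= k IH hk; rewrite /history /= -/(history _ k) IH; last by lia.
congr (rcons _ (_, _ / _)).
rewrite drop_cat; have -> : (k * (2 * m) + m < size h)%N by lia.
by rewrite takel_cat // size_drop; lia.
Qed.

(** Here [h1] is the part of block [k] already played. The algorithm recomputes the arm in every
    round, but from completed blocks only, so the arm stays the same throughout the block. *)
Lemma play_from_block h h1 bs k :
  size h = (k * (2 * m))%N -> (k < T %/ (2 * m))%N ->
  (size h1 + size bs <= 2 * m)%N ->
  play_from alg (h ++ h1) bs =
  h ++ h1 ++ zip (drop (size h1) (S (pi (history h k)))) bs.
Proof.
move=> hk kT; elim: bs h1 => [|b bs IH] h1 /= sz; first by case: drop => *; rewrite cats0.
have algE : alg (h ++ h1) = nth (rest (h ++ h1)) (S (pi (history h k))) (size h1).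
  rewrite /alg /unknown_opponent_alg size_cat hk.
  rewrite divnMDl ?muln_gt0 // modnMDl divn_small ?modn_small ?addn0; [|lia|lia].
  by rewrite kT -/(history _ _) bandit_history_cat // hk.
rewrite rcons_cat IH; last by rewrite size_rcons; lia.
rewrite (drop_nth (rest (h ++ h1)) (n := size h1)) ?size_tuple; last by lia.
by rewrite /= size_rcons -algE cat_rcons.
Qed.

Lemma map_fst_zip (X Y : Type) (s : seq X) (t : seq Y) :
  [seq z.1 | z <- zip s t] = take (size t) s.
Proof. by elim: s t => [|x s IH] [|y t] //=; rewrite IH. Qed.

(** The law of B's actions in the second half of a block. It is a product because A's actions in the
    block are fixed in advance. *)
Definition arm_prob (i : I) (w : m.-tuple B) : R :=
  \prod_(t < m) reply (take (m + t) (S i)) (tnth w t).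

Definition arm_reward (i : I) (w : m.-tuple B) : R :=
  (\sum_(z <- zip (drop m (S i)) w) u z.1 z.2) / m%:R.

(** Induction on the blocks: the first half is discarded, the second is expanded into a pull with
    law [arm_prob]. The last [rem] rounds only contribute nonnegative payoffs. *)
Lemma value_to_go_block n rem h k :
  size h = (k * (2 * m))%N -> (k + n <= T %/ (2 * m))%N ->
  m%:R * bandit_value arm_prob arm_reward pi n (history h k)
    <= value_to_go alg (n * (2 * m) + rem) h.
Proof.
elim: n h k => [|n IH] h k hk kT; first by rewrite /= mulr0 value_to_go_ge0.
have -> : (n.+1 * (2 * m) + rem = m + (m + (n * (2 * m) + rem)))%N by lia.
apply: value_to_go_ge => bs bsz.
have kT' : (k < T %/ (2 * m))%N by lia.
rewrite -[X in play_from _ X]cats0 (@play_from_block _ _ _ k) //=; last by lia.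
rewrite drop0; set i := pi _; set h1 := zip (S i) bs.
have h1sz : size h1 = m by rewrite size_zip size_tuple bsz; lia.
have h1fst : [seq z.1 | z <- h1] = take m (S i) by rewrite map_fst_zip bsz.
rewrite -[leRHS]add0r value_to_go_unfold mulr_sumr; apply: ler_sum => w _.
rewrite (@play_from_block _ _ _ k) //; last by rewrite h1sz size_tuple; lia.
rewrite -/i h1sz; set z := zip _ _.
have zsz : size z = m by rewrite size_zip size_drop !size_tuple; lia.
(* At least [m] actions of the current block precede these rounds, so the memory does not reach back
   into [h]. *)
have -> : \prod_(t < m) reply [seq z0.1 | z0 <- take (size (h ++ h1) + t) (h ++ h1 ++ z)]
    (tnth w t) = arm_prob i w.
  apply: eq_bigr => t _; have tm := ltn_ord t.
  rewrite catA takeD take_size_cat // drop_size_cat // !map_cat h1fst.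
  rewrite map_take map_fst_zip size_tuple.
  by rewrite take_takel; [rewrite -catA -takeD reply_cat // size_takel ?size_tuple; lia | lia].
rewrite catA drop_size_cat // add0r mulrCA; apply: ler_wpM2l.
  by apply: prodr_ge0 => t _; exact: (reply_dist _).1.
rewrite mulrDr /arm_reward mulrCA divff ?pnatr_eq0 -?lt0n // mulr1 lerD2l.
have := IH ((h ++ h1) ++ z) k.+1; rewrite !size_cat h1sz zsz hk.
move=> /(_ ltac:(lia) ltac:(lia)).
rewrite /history /= -/(history _ k) -catA bandit_history_cat ?hk // -/i.
suff -> : block_reward u m (h ++ h1 ++ z) k = arm_reward i w by [].
rewrite /block_reward catA drop_size_cat ?size_cat ?hk ?h1sz // take_oversize //.
by rewrite zsz.
Qed.

Lemma arm_prob_dist i : is_dist (arm_prob i).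
Proof.
split=> [w|]; first by apply: prodr_ge0 => t _; exact: (reply_dist _).1.
apply: (@sum_product_measure _ _ _ (fun t => reply (take (m + t) (S i)))) => t.
exact: reply_dist.
Qed.

Lemma arm_rewardE a0 i w :
  arm_reward i w = (\sum_(t < m) u (nth a0 (S i) (m + t)) (tnth w t)) / m%:R.
Proof.
pose b0 := tnth w (Ordinal m_gt0).
rewrite /arm_reward (big_nth (a0, b0)) size_zip size_drop !size_tuple.
have -> : minn (2 * m - m) m = m by lia.
rewrite big_mkord; congr (_ / _); apply: eq_bigr => t _.
rewrite nth_zip_cond size_zip size_drop !size_tuple.
have -> : (t < minn (2 * m - m) m)%N by have := ltn_ord t; lia.
by rewrite /= nth_drop (tnth_nth b0).
Qed.

Lemma arm_reward01 i w : 0 <= arm_reward i w <= 1.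
Proof.
have m0 : 0 < m%:R :> R by rewrite ltr0n.
have lt02m : (0 < 2 * m)%N by rewrite muln_gt0.
pose a0 := tnth (S i) (Ordinal lt02m).
have v01 (t : 'I_m) : 0 <= u (nth a0 (S i) (m + t)) (tnth w t) <= 1 by exact: u01.
rewrite (arm_rewardE a0) divr_ge0 ?ler0n ?sumr_ge0 //= => [|t _]; last first.
  by case/andP: (v01 t).
rewrite ler_pdivrMr // mul1r -[m in leRHS]card_ord -sumr_const.
by apply: ler_sum => t _; case/andP: (v01 t).
Qed.

Lemma mean_arm i : mean arm_prob arm_reward i = last_m_payoff u f (S i) / m%:R.
Proof.
have lt02m : (0 < 2 * m)%N by rewrite muln_gt0.
pose a0 := tnth (S i) (Ordinal lt02m).
rewrite (last_m_payoff_at a0) /mean.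
under eq_bigr => w _ do rewrite (arm_rewardE a0) mulrA.
rewrite -mulr_suml; congr (_ / _).
by rewrite (@expected_sum_product_measure _ _ _ (fun t => reply (take (m + t) (S i)))
  (fun t => u (nth a0 (S i) (m + t)))) // => t; exact: reply_dist.
Qed.
End Rounds.

Theorem theorem7 (R : realType) :
  exists C : R,
    forall (A B I : finType) (uA uB : A -> B -> R) (m T : nat)
      (F : I -> {ffun A -> nat} -> B -> R) (fstar : I) (blank : A)
      (S : I -> (2 * m).-tuple A) (pi : seq (I * R) -> I)
      (rest : seq (A * B) -> A),
    (1 <= m)%N ->
    (forall i, is_rule m (F i)) ->
    (forall a b, 0 <= uA a b <= 1) ->
    is_blank uA uB m F blank ->
    (forall i, is_best_block uA (F i) (S i)) ->
    is_moss (T %/ (2 * m)) pi ->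
    strategy_payoff uA m (F fstar) (unknown_opponent_alg uA T S pi rest) T >=
      2^-1 * opt uA m (F fstar) T
      - C * (Num.sqrt (#|I| * m * T)%N%:R + m%:R).
Proof.
exists 55 => A B I uA uB m T F fstar blank S pi rest m_gt0 rule u01 [_ isblank] best moss.
set V := last_m_payoff uA (F fstar) (S fstar).
set N := (T %/ (2 * m))%N in moss *.
have mR : 0 < m%:R :> R by rewrite ltr0n.
have V0 : 0 <= V by exact: (last_m_payoff_ge0 (rule _) u01).
have Vm : V <= m%:R by exact: (last_m_payoff_le (rule _) u01).
(* A window has [m] rounds and a block [2 * m], so [2 * N + 2] windows suffice. Half of this bound
   exceeds [N * V] by [V <= m], which the additive term in [m] absorbs. *)
have optV : opt uA m (F fstar) T <= (2 * N%:R + 2) * V.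
  have := opt_le (rule _) u01 T m_gt0 (isblank fstar) (best fstar).
  move=> /le_trans; apply; apply: ler_wpM2r => //.
  have : ((T %/ m).+1 <= 2 * N + 2)%N.
    have -> : N = (T %/ m %/ 2)%N by rewrite /N mulnC divnMA.
    have := divn_eq (T %/ m) 2; have := ltn_pmod (T %/ m) (isT : 0 < 2)%N.
    lia.
  by rewrite -(ler_nat R) natrD natrM.
pose p := @arm_prob R A B m (F fstar) I S.
pose r := @arm_reward R A B uA m I S.
have meanE i : mean p r i = last_m_payoff uA (F fstar) (S i) / m%:R.
  exact: mean_arm.
have regret : N%:R * (V / m%:R) - bandit_value p r pi N [::]
    <= 55 * Num.sqrt (#|I| * N)%N%:R.
  rewrite -meanE; apply: moss_regret moss => [i|i o|i].
  - exact: arm_prob_dist.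
  - exact: arm_reward01.
  (* Against the true rule, [S fstar] is optimal among all blocks, in particular among the [S i]. *)
  - by rewrite !meanE ler_pM2r ?invr_gt0 // best.
(* A unit of bandit regret is worth [m] in payoff; [N * m <= T] moves this factor under the root. *)
have sqrt_le : m%:R * Num.sqrt (#|I| * N)%N%:R <= Num.sqrt (#|I| * m * T)%N%:R :> R.
  rewrite -ler_sqr ?nnegrE ?mulr_ge0 ?sqrtr_ge0 ?ler0n // exprMn.
  rewrite !sqr_sqrtr ?ler0n // -natrX -natrM ler_nat.
  have NT : (N * m <= T)%N.
    by apply: leq_trans (leq_trunc_div T (2 * m)); rewrite leq_mul2l leq_pmull ?orbT.
  have -> : (m ^ 2 * (#|I| * N) = #|I| * m * (N * m))%N by lia.
  by rewrite leq_mul2l NT orbT.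
rewrite (strategy_payoffE _ (rule _)).
have := @value_to_go_block R A B uA m (F fstar) (rule _) u01 I T S pi rest m_gt0 N
  (T %% (2 * m)) [::] 0 erefl (leqnn N).
rewrite -divn_eq /= -/p -/r; apply: le_trans.
have : m%:R * (N%:R * (V / m%:R)) = N%:R * V by field; rewrite gt_eqF.
have := ler_wpM2l (ltW mR) regret; lra.
Qed.
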